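(* Every sparse paving matroid is balanced. That is: let $M=(E,\mathcal{B})$ be a paving matroid of rank $r$ on a finite ground set $E$, let $\mathcal{C}_r$ be its collection of circuits of size $r$, and suppose that $|C\oplus C'|>2$ for all distinct $C,C'\in\mathcal{C}_r$. Then every minor $N$ of $M$ (including $M$ itself) has the negative correlation property: for all distinct elements $e,f$ of the ground set of $N$ such that $f$ is not a loop of $N$, if $X$ is a basis of $N$ chosen uniformly at random, then $\Pr(e\in X\mid f\in X)\le \Pr(e\in X)$.
   Context: A matroid $M=(E,\mathcal{B})$ is given by a finite ground set $E$ and its (nonempty) collection of bases $\mathcal{B}\subseteq 2^E$; all bases have the same size $r$, the rank of $M$. A subset of $E$ is independent if it is contained in some basis, and dependent otherwise; a circuit is a minimal dependent set. A loop is an element contained in no basis; a coloop is an element contained in every basis. The symbol $\oplus$ denotes symmetric difference. $M$ of rank $r$ is paving if all $(r-1)$-element subsets of $E$ are independent; then every $r$-element subset of $E$ is either a basis or a circuit. A paving matroid of rank $r$ is sparse if $|C\oplus C'|>2$ for all distinct circuits $C,C'$ of size $r$. If $e\in E$ is neither a loop nor a coloop, the deletion $M\setminus e$ has ground set $E\setminus\{e\}$ and bases $\{X\subseteq E\setminus\{e\}: X\in\mathcal{B}\}$; the contraction $M/e$ has ground set $E\setminus\{e\}$ and bases $\{X\subseteq E\setminus\{e\}: X\cup\{e\}\in\mathcal{B}\}$. A minor of $M$ is any matroid obtained from $M$ by a (possibly empty) series of deletions and contractions. A matroid has the negative correlation property if $\Pr(e\in X\mid f\in X)\le\Pr(e\in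 X)$ for all distinct ground set elements $e,f$ with $f$ not a loop, where $X$ is a uniformly random basis. A matroid is balanced if all its minors (including itself) have the negative correlation property. *)

(* Defs.v *)
From HB Require Import structures.
From mathcomp Require Import all_boot all_order all_algebra.

Set Implicit Arguments.
Unset Strict Implicit.
Unset Printing Implicit Defensive.

Import Order.TTheory GRing.Theory Num.Theory.
Local Open Scope ring_scope.

(* The ground set is an arbitrary subset of an ambient finite type [T], so that
   a matroid and all its minors live in the same type [matroid T]. *)
Record matroid (T : finType) := Matroid {
  ground : {set T};
  bases : {set {set T}};
  bases_neq0 : bases != set0;
  bases_sub : forall X, X \in bases -> X \subset ground;
  bases_exchange : forall X Y x, X \in bases -> Y \in bases -> x \in X :\: Y ->
    exists2 y, y \in Y :\: X & y |: (X :\ x) \in bases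
}.

Section MatroidTheory.
Variable T : finType.
Implicit Types (M N : matroid T) (A C X Y : {set T}) (e f : T).

Definition rank M : nat := \max_(X in bases M) #|X|.

Lemma leq_card_bases M X Y :
  X \in bases M -> Y \in bases M -> (#|X| <= #|Y|)%N.
Proof.
have [n] := ubnP #|X :\: Y|; elim: n => // n IHn in X * => le_n bX bY.
have [/eqP|[x xXY]] := set_0Vmem (X :\: Y).
  by rewrite setD_eq0 => /subset_leq_card.
have [y yYX bZ] := bases_exchange bX bY xXY.
move: (xXY) (yYX); rewrite !inE => /andP[xNY xX] /andP[yNX yY].
have cZ : #|y |: (X :\ x)| = #|X|.
  by rewrite cardsU1 !inE (negbTE yNX) andbF add1n (cardsD1 x X) xX.
rewrite -cZ; apply: IHn => //.
suff: (#|(y |: (X :\ x)) :\: Y| < #|X :\: Y|)%N.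
  by move=> lt; apply: leq_trans lt _; rewrite -ltnS.
rewrite (cardsD1 x (X :\: Y)) xXY ltnS; apply/subset_leq_card/subsetP => z.
rewrite !inE => /andP[zNY]; case/orP => [/eqP zy|/andP[-> ->]].
  by rewrite zy yY in zNY.
by rewrite zNY.
Qed.

Lemma card_bases M X : X \in bases M -> #|X| = rank M.
Proof.
move=> bX; apply/eqP; rewrite eqn_leq; apply/andP; split.
  exact: (@leq_bigmax_cond _ (mem (bases M)) (fun Y : {set T} => #|Y|) X bX).
by apply/bigmax_leqP => Y bY; apply: leq_card_bases bY bX.
Qed.

Definition independent M A : bool := [exists X in bases M, A \subset X].

Definition dependent M A : bool := (A \subset ground M) && ~~ independent M A.

Definition circuit M C : bool := minset (dependent M) C.

Definition loop M e : bool :=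
  (e \in ground M) && [forall X in bases M, e \notin X].

Definition coloop M e : bool :=
  (e \in ground M) && [forall X in bases M, e \in X].

Definition symdiff A C : {set T} := (A :\: C) :|: (C :\: A).

(* [#|A|.+1 = rank M] says that [A] has [r - 1] elements, with the integer
   subtraction: for [r = 0] there is no such [A]. *)
Definition paving M : Prop :=
  forall A, A \subset ground M -> #|A|.+1 = rank M -> independent M A.

Definition sparse_paving M : Prop :=
  paving M /\
  forall C C', circuit M C -> circuit M C' ->
    #|C| = rank M -> #|C'| = rank M -> C != C' -> (2 < #|symdiff C C'|)%N.

Definition removable M e : bool :=
  [&& e \in ground M, ~~ loop M e & ~~ coloop M e].

Definition deletion_bases M e : {set {set T}} :=
  [set X : {set T} | (X \subset ground M :\ e) && (X \in bases M)].

Definition contraction_bases M e : {set {set T}} :=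
  [set X : {set T} | (X \subset ground M :\ e) && (e |: X \in bases M)].

Lemma deletion_neq0 M e : removable M e -> deletion_bases M e != set0.
Proof.
case/and3P=> eM _; rewrite /coloop eM /= => /forall_inPn[X bX eX].
apply/set0Pn; exists X; rewrite inE bX andbT.
by rewrite subsetD1 eX (bases_sub bX).
Qed.

Lemma deletion_sub M e X : X \in deletion_bases M e -> X \subset ground M :\ e.
Proof. by rewrite inE => /andP[]. Qed.

Lemma deletion_exchange M e X Y x :
    X \in deletion_bases M e -> Y \in deletion_bases M e -> x \in X :\: Y ->
  exists2 y, y \in Y :\: X & y |: (X :\ x) \in deletion_bases M e.
Proof.
rewrite !inE => /andP[sX bX] /andP[sY bY] xXY.
have [|y yYX bZ] := bases_exchange bX bY (x := x); first by rewrite !inE.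
exists y => //; rewrite inE bZ andbT subUset sub1set.
move: yYX; rewrite inE => /andP[_ yY]; rewrite (subsetP sY) //=.
exact: subset_trans (subsetDl _ _) sX.
Qed.

Lemma contraction_neq0 M e : removable M e -> contraction_bases M e != set0.
Proof.
case/and3P=> eM; rewrite /loop eM /= => /forall_inPn[X bX /negPn eX] _.
apply/set0Pn; exists (X :\ e); rewrite inE setD1K // bX andbT.
exact: setSD (bases_sub bX).
Qed.

Lemma contraction_sub M e X :
  X \in contraction_bases M e -> X \subset ground M :\ e.
Proof. by rewrite inE => /andP[]. Qed.

Lemma contraction_exchange M e X Y x :
    X \in contraction_bases M e -> Y \in contraction_bases M e ->
    x \in X :\: Y ->
  exists2 y, y \in Y :\: X & y |: (X :\ x) \in contraction_bases M e.
Proof.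
rewrite !inE => /andP[sX bX] /andP[sY bY] /andP[xNY xX].
have xe : x != e by have := subsetP sX x xX; rewrite !inE => /andP[].
have [|y yYX bZ] := bases_exchange bX bY (x := x).
  by rewrite !inE negb_or xe xNY xX orbT.
move: yYX; rewrite !inE negb_or => /andP[/andP[ye yNX]].
rewrite (negbTE ye) /= => yY.
exists y; first by rewrite inE yNX.
rewrite inE subUset sub1set (subsetP sY) //=.
rewrite (subset_trans (subsetDl _ _) sX) /=.
suff -> : e |: (y |: (X :\ x)) = y |: ((e |: X) :\ x) by [].
apply/setP => z; rewrite !inE.
by case: (eqVneq z e) => [->|]; rewrite ?[e == x]eq_sym ?xe ?orbT.
Qed.

Definition deletion M e (he : removable M e) : matroid T :=
  Matroid (deletion_neq0 he) (@deletion_sub M e) (@deletion_exchange M e).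

Definition contraction M e (he : removable M e) : matroid T :=
  Matroid (contraction_neq0 he) (@contraction_sub M e)
    (@contraction_exchange M e).

Inductive minor M : matroid T -> Prop :=
| minor_refl : minor M M
| minor_deletion N e (he : removable N e) :
    minor M N -> minor M (deletion he)
| minor_contraction N e (he : removable N e) :
    minor M N -> minor M (contraction he).

(* Probability of the event [P] for a uniformly random basis of [M]. *)
Definition Pr M (P : pred {set T}) : rat :=
  #|[set X in bases M | P X]|%:R / #|bases M|%:R.

Definition condPr M (P Q : pred {set T}) : rat :=
  Pr M (predI P Q) / Pr M Q.

Definition negative_correlation M : Prop :=
  forall e f, e \in ground M -> f \in ground M -> e != f -> ~~ loop M f ->
    condPr M (fun X => e \in X) (fun X => f \in X) <= Pr M (fun X => e \in X).

Definition balanced M : Prop := forall N, minor M N -> negative_correlation N.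

End MatroidTheory.

(* Main.v *)
Require Import Defs.
From HB Require Import structures.
From mathcomp Require Import all_boot all_order all_algebra.
From mathcomp Require Import zify.

Set Implicit Arguments.
Unset Strict Implicit.
Unset Printing Implicit Defensive.

(** Let [r] be the rank. Being sparse paving says that the [r]-subsets of the
    ground set that are not bases pairwise differ in more than two elements,
    and this property passes to minors. Given [e] and [f], put [m = |E| - 2]
    and [w = r - 1 = m - v], and write [p], [q], [s], [t] for the number of
    bases meeting [{e, f}] in [{e, f}], [{e}], [{f}], the empty set; negative
    correlation amounts to [p * t <= q * s]. Trivially [p <= 'C(m, w - 1)] and
    [t <= 'C(m, w + 1)]. The [w]-sets [A] for which [e |: A] is not a basis
    have pairwise disjoint upper shadows, so [q >= w / (w + 1) * 'C(m, w)];
    those for which [f |: A] is not a basis have pairwise disjoint lower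
    shadows, so [s >= v / (v + 1) * 'C(m, w)]. Since
    ['C(m, w - 1) = w / (v + 1) * 'C(m, w)] and
    ['C(m, w + 1) = v / (w + 1) * 'C(m, w)], the inequality follows. *)

(** * Set families with pairwise distance above two, and their shadows *)

Section Codes.
Variable T : finType.
Implicit Types (A B S E : {set T}) (F : {set {set T}}).

Definition separated F : Prop :=
  forall A B, A \in F -> B \in F -> A != B -> 2 < #|symdiff A B|.

(** Lets a common part be stripped from the members of a family without changing distances, as
    needed for contractions and for links. *)
Lemma symdiff_setUl S A B :
  [disjoint S & A] -> [disjoint S & B] ->
  symdiff (S :|: A) (S :|: B) = symdiff A B.
Proof.
move=> dA dB; apply/setP => z; rewrite !inE.
have [zS|] := boolP (z \in S) => //=.
by rewrite (disjointFr dA zS) (disjointFr dB zS).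
Qed.

Lemma separated_eq F A B x y : separated F -> A \in F -> B \in F ->
  symdiff A B \subset [set x; y] -> A = B.
Proof.
move=> sepF AF BF sub; apply/eqP/negPn/negP => /(sepF _ _ AF BF).
move: (subset_leq_card sub); rewrite cards2; lia.
Qed.

Lemma card_sig_sets F (G : {set T} -> {set T}) :
  #|[set u : {set T} * T | (u.1 \in F) && (u.2 \in G u.1)]|
    = \sum_(A in F) #|G A|.
Proof.
under eq_bigr do rewrite -sum1_card.
by rewrite pair_big_dep -sum1_card; apply: eq_bigl => u; rewrite inE.
Qed.

(** Sending a pair [(A, x)] with [x] in [A] to [A :\ x] is injective: sets with a common image
    differ at most in the two deleted elements, hence coincide by separation. There are [w.+1] pairs
    for each [A]. *)
Lemma lower_shadow_bound E F w : separated F ->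
  (forall A, A \in F -> A \subset E /\ #|A| = w.+1) ->
  w.+1 * #|F| <= 'C(#|E|, w).
Proof.
move=> sepF wF; rewrite -cards_draws.
set D := [set u : {set T} * T | (u.1 \in F) && (u.2 \in u.1)].
have -> : w.+1 * #|F| = #|D|.
  rewrite (card_sig_sets F id) mulnC -sum_nat_const.
  by apply: eq_bigr => A /wF[].
rewrite -(card_in_imset (f := fun u => u.1 :\ u.2) (D := mem D)).
  apply/subset_leq_card/subsetP => _ /imsetP[[A x] + ->].
  rewrite !inE /= => /andP[/wF[AE cA] xA].
  rewrite (subset_trans (subD1set _ _) AE).
  by move: (cardsD1 x A); rewrite xA; lia.
move=> [A x] [B y]; rewrite !inE /= => /andP[AF xA] /andP[BF yB] eqAB.
have AB : A = B.
  apply: (@separated_eq F _ _ x y) => //; apply/subsetP => z.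
  move/setP/(_ z): eqAB; rewrite !inE.
  by case: (z == x); case: (z == y); case: (z \in A); case: (z \in B).
rewrite -AB in eqAB *; congr (_, _).
by move/setP/(_ x): eqAB; rewrite !inE eqxx xA !andbT => /esym/negbFE/eqP.
Qed.

(** Dual count: the pairs [(A, x)] now have [x] in [E] outside [A] and are sent to [x |: A]. *)
Lemma upper_shadow_bound E F w : separated F ->
  (forall A, A \in F -> A \subset E /\ #|A| = w) ->
  (#|E| - w) * #|F| <= 'C(#|E|, w.+1).
Proof.
move=> sepF wF; rewrite -cards_draws.
set D := [set u : {set T} * T | (u.1 \in F) && (u.2 \in E :\: u.1)].
have -> : (#|E| - w) * #|F| = #|D|.
  rewrite (card_sig_sets F (fun A => E :\: A)) mulnC -sum_nat_const.
  by apply: eq_bigr => A /wF[AE cA]; rewrite cardsDS // cA.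
rewrite -(card_in_imset (f := fun u => u.2 |: u.1) (D := mem D)).
  apply/subset_leq_card/subsetP => _ /imsetP[[A x] + ->].
  rewrite !inE /= => /andP[/wF[AE cA] /andP[xNA xE]].
  by rewrite subUset sub1set xE AE cardsU1 xNA cA add1n eqxx.
move=> [A x] [B y]; rewrite !inE /= => /andP[AF /andP[xA _]].
move=> /andP[BF /andP[yB _]] eqAB.
have AB : A = B.
  apply: (@separated_eq F _ _ x y) => //; apply/subsetP => z.
  move/setP/(_ z): eqAB; rewrite !inE.
  by case: (z == x); case: (z == y); case: (z \in A); case: (z \in B).
rewrite -AB in eqAB *; congr (_, _).
by move/setP/(_ x): eqAB; rewrite !inE eqxx (negbTE xA) !orbF => /esym/eqP.
Qed.

End Codes.

(** * Non-bases of rank size and their behaviour under minors *)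

Section SparsePaving.
Variable T : finType.
Implicit Types (M N : matroid T) (A P S X : {set T}) (e f : T).

Definition nonbases M : {set {set T}} :=
  [set X : {set T} |
    [&& X \subset ground M, #|X| == rank M & X \notin bases M]].

Lemma ex_basis M : exists X, X \in bases M.
Proof. exact/set0Pn/bases_neq0. Qed.

(** A proper subset of [X] misses some [x] in [X], so it lies in [X :\ x], which has one element
    less than the rank and is independent by paving. *)
Lemma paving_nonbasis_circuit M X :
  paving M -> X \in nonbases M -> circuit M X.
Proof.
move=> pavM; rewrite inE => /and3P[XM /eqP cX XNb].
apply/minsetP; split.
  rewrite /dependent XM; apply/negP => /exists_inP[B bB XB].
  suff XeB : X = B by rewrite XeB bB in XNb.
  by apply/eqP; rewrite eqEcard XB cX (card_bases bB) leqnn.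
move=> B /andP[BM BNi] BX; apply/eqP; rewrite eqEsubset BX.
apply/negPn/negP => /subsetPn[x xX xNB]; case/negP: BNi.
have/exists_inP[C bC sC] : independent M (X :\ x).
  apply: pavM; first exact: subset_trans (subD1set _ _) XM.
  by rewrite -cX (cardsD1 x X) xX.
apply/exists_inP; exists C => //.
by apply: subset_trans sC; rewrite subsetD1 BX.
Qed.

Lemma sparse_paving_separated M : sparse_paving M -> separated (nonbases M).
Proof.
move=> [pavM spM] A B bA bB; apply: spM; try exact: paving_nonbasis_circuit.
  by move: bA; rewrite inE => /and3P[_ /eqP].
by move: bB; rewrite inE => /and3P[_ /eqP].
Qed.

Lemma rank_deletion M e (he : removable M e) : rank (deletion he) = rank M.
Proof.
have [X bX] := ex_basis (deletion he); rewrite -(card_bases bX).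
by move: bX; rewrite inE => /andP[_ /card_bases].
Qed.

Lemma rank_contraction M e (he : removable M e) :
  (rank (contraction he)).+1 = rank M.
Proof.
have [X bX] := ex_basis (contraction he); rewrite -(card_bases bX).
move: bX; rewrite inE subsetD1 => /andP[/andP[_ eX] /card_bases <-].
by rewrite cardsU1 eX.
Qed.

Lemma nonbases_deletion M e (he : removable M e) X :
  X \in nonbases (deletion he) -> X \in nonbases M.
Proof.
rewrite !inE rank_deletion /= => /and3P[XM -> ]; rewrite XM /= => ->.
by rewrite (subset_trans XM) ?subD1set.
Qed.

Lemma nonbases_contraction M e (he : removable M e) X :
  X \in nonbases (contraction he) -> e \notin X /\ e |: X \in nonbases M.
Proof.
rewrite !inE -(rank_contraction he) /= => /and3P[XM /eqP <-].
rewrite XM /= => ->; move: XM; rewrite subsetD1 => /andP[XM eX]; split=> //.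
by rewrite subUset sub1set XM cardsU1 eX eqxx; case/and3P: he => ->.
Qed.

(** Non-bases of a deletion are non-bases of the original matroid; those of a contraction become so
    once [e] is put back, which preserves distances. *)
Lemma separated_minor M N :
  separated (nonbases M) -> minor M N -> separated (nonbases N).
Proof.
move=> sepM; elim=> // {}N e he _ sepN A B.
  by move=> /nonbases_deletion bA /nonbases_deletion; apply: sepN.
move=> /nonbases_contraction[eA bA] /nonbases_contraction[eB bB] neqAB.
rewrite -(@symdiff_setUl _ [set e]) ?disjoints1 //; apply: sepN => //.
apply: contra_neq neqAB => eqAB.
by rewrite -(setU1K eA) -(setU1K eB) eqAB.
Qed.

(** * Counting bases by their trace on a fixed set *)

Definition bases_trace M P S : {set {set T}} :=
  [set X in bases M | X :&: P == S].

(** Keeps only the part of a basis outside [P], so that the classes for different traces all become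
    families of subsets of one set. *)
Definition trace_link M P S : {set {set T}} :=
  [set A : {set T} | (A \subset ground M :\: P) && (S :|: A \in bases M)].

Lemma card_bases_trace M P S :
  S \subset P -> #|bases_trace M P S| = #|trace_link M P S|.
Proof.
move=> SP; pose g A := S :|: A.
rewrite -(card_in_imset (f := g) (D := mem (trace_link M P S))).
  apply: eq_card => X; rewrite inE.
  apply/andP/imsetP => [[bX /eqP XP]|[A + ->]].
    exists (X :\: P); last by rewrite /g -XP setID.
    by rewrite inE -XP setID bX setSD // bases_sub.
  rewrite inE subsetD => /andP[/andP[_ dAP] bA]; split=> //.
  by rewrite /g setIUl (setIidPl SP) (disjoint_setI0 dAP) setU0.
have rec A : A \in trace_link M P S -> A = g A :\: P.
  rewrite inE subsetD => /andP[/andP[_ dAP] _].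
  move: SP; rewrite -setD_eq0 => /eqP SP.
  by rewrite /g setDUl SP set0U; apply/esym/setDidPl.
by move=> A B /rec {2}-> /rec {2}-> ->.
Qed.

Lemma card_trace_link M P S A : S \subset P ->
  A \in trace_link M P S -> #|S| + #|A| = rank M.
Proof.
move=> SP; rewrite inE subsetD => /andP[/andP[_ dAP] /card_bases <-].
rewrite cardsU disjoint_setI0 ?cards0 ?subn0 //.
by rewrite disjoint_sym; apply: disjointWr dAP.
Qed.

Lemma bases_trace_le M P S k : S \subset P -> rank M = #|S| + k ->
  #|bases_trace M P S| <= 'C(#|ground M :\: P|, k).
Proof.
move=> SP rM; rewrite card_bases_trace // -cards_draws.
apply/subset_leq_card/subsetP => A Al; rewrite inE.
by have := card_trace_link SP Al; move: Al; rewrite inE => /andP[-> _]; lia.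
Qed.

Definition nonbasis_link M P S : {set {set T}} :=
  [set A : {set T} | (A \subset ground M :\: P) && (S :|: A \in nonbases M)].

(** Adjoining [S] to a [k]-subset outside [P] gives a set of rank size, which is either a basis or a
    non-basis. *)
Lemma bases_trace_compl M P S k : S \subset P -> S \subset ground M ->
    rank M = #|S| + k ->
  #|bases_trace M P S| + #|nonbasis_link M P S| = 'C(#|ground M :\: P|, k).
Proof.
move=> SP SM rM; rewrite card_bases_trace // -cards_draws.
rewrite -(cardsID [set A | S :|: A \in bases M] [set A : {set T} | _ & _]).
congr (_ + _); apply: eq_card => A.
  rewrite !inE; apply/idP/idP => [Al|/andP[/andP[-> _] //]].
  have Al' : A \in trace_link M P S by rewrite inE.
  by have := card_trace_link SP Al'; case/andP: Al => -> ->; lia.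
rewrite !inE subUset SM /= subsetD.
case: (boolP (A \subset _)) => AM /=; last by rewrite andbF.
have [dAP|] := boolP [disjoint A & P]; last by rewrite andbF.
have dSA : [disjoint S & A].
  by rewrite disjoint_sym; apply: disjointWr dAP.
rewrite cardsU disjoint_setI0 // cards0 subn0 rM eqn_add2l.
by rewrite /= andbC.
Qed.

Lemma nonbasis_linkP M P S k A : S \subset P -> rank M = #|S| + k ->
  A \in nonbasis_link M P S -> A \subset ground M :\: P /\ #|A| = k.
Proof.
move=> SP rM; rewrite !inE => /andP[AE /and3P[_ /eqP cSA _]]; split=> //.
move: AE; rewrite subsetD => /andP[_ dAP].
suff dSA : [disjoint S & A].
  by move: cSA; rewrite cardsU disjoint_setI0 // cards0; lia.
by rewrite disjoint_sym; apply: disjointWr dAP.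
Qed.

Lemma separated_nonbasis_link M P S : S \subset P ->
  separated (nonbases M) -> separated (nonbasis_link M P S).
Proof.
move=> SP sepM A B; rewrite [A \in _]inE [B \in _]inE !subsetD.
move=> /andP[/andP[_ dA] bA] /andP[/andP[_ dB] bB] neqAB.
have dSA : [disjoint S & A] by rewrite disjoint_sym; apply: disjointWr dA.
have dSB : [disjoint S & B] by rewrite disjoint_sym; apply: disjointWr dB.
rewrite -(symdiff_setUl dSA dSB); apply: sepM => //.
apply: contra_neq neqAB => /(congr1 (fun X => X :\: S)).
rewrite !setDUl setDv !set0U.
by rewrite (setDidPl _) 1?disjoint_sym // (setDidPl _) 1?disjoint_sym.
Qed.

(** The arithmetic core. [F] and [G] are bounded through shadows of opposite kinds, so that the
    product of the resulting lower bounds on [q] and [s] is exactly ['C(m, w.-1) * 'C(m, w.+1)]. *)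
Lemma shadow_inequality m w p q s t F G :
    0 < w < m ->
    p <= 'C(m, w.-1) -> t <= 'C(m, w.+1) ->
    q + F = 'C(m, w) -> s + G = 'C(m, w) ->
    (m - w) * F <= 'C(m, w.+1) -> w * G <= 'C(m, w.-1) ->
  p * t <= q * s.
Proof.
(* From here on [w], and the [v] introduced below, are one less than in the overview. *)
case: w => // w /=; set C := 'C(m, w.+1) => w_lt.
have := mul_bin_left m w; have := mul_bin_left m w.+1; rewrite -/C.
set U := 'C(m, w.+2); set L := 'C(m, w).
have [v ->] : exists v, m = w.+2 + v by exists (m - w.+2); lia.
rewrite (_ : _ - w.+1 = v.+1) 1?(_ : _ - w = v.+2); try lia.
move=> eU eL pL tU qF sG FU GL.
have qC : w.+1 * C <= w.+2 * q.
  suff : w.+2 * F <= C by lia.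
  by rewrite -(leq_pmul2l (ltn0Sn v)) -eU mulnCA leq_pmul2l.
have sC : v.+1 * C <= v.+2 * s.
  suff : v.+2 * G <= C by lia.
  by rewrite -(leq_pmul2l (ltn0Sn w)) eL mulnCA leq_pmul2l.
apply: leq_trans (leq_mul pL tU) _.
(* This factor clears the denominators of [qC] and [sC], and [eU] and [eL] turn the left side into a
   multiple of [C * C]. *)
rewrite -(leq_pmul2l (isT : 0 < w.+2 * v.+2)).
have -> : w.+2 * v.+2 * (L * U) = (w.+1 * C) * (v.+1 * C).
  by rewrite -eU eL; lia.
by rewrite [leqRHS]mulnACA leq_mul.
Qed.

Lemma bases_trace_inequality M e f : separated (nonbases M) ->
    e \in ground M -> f \in ground M -> e != f ->
  #|bases_trace M [set e; f] [set e; f]| * #|bases_trace M [set e; f] set0|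
    <= #|bases_trace M [set e; f] [set e]|
       * #|bases_trace M [set e; f] [set f]|.
Proof.
move=> sepM eM fM ef; set P := [set e; f]; pose m := #|ground M :\: P|.
have cP : #|P| = 2 by rewrite cards2 ef.
have eP : [set e] \subset P by rewrite sub1set !inE eqxx.
have fP : [set f] \subset P by rewrite sub1set !inE eqxx orbT.
have trace0 S : S \subset P -> ~~ (#|S| <= rank M <= m + #|S|) ->
    #|bases_trace M P S| = 0.
  move=> SP; apply: contraNeq; rewrite card_bases_trace // cards_eq0.
  case/set0Pn=> A Al; have := card_trace_link SP Al.
  by move: Al; rewrite inE => /andP[/subset_leq_card + _]; rewrite -/m; lia.
(* In rank below two no basis contains both [e] and [f]; in rank above [m] none avoids both. Either
   way the left side vanishes, and the remaining ranks are those with [0 < rank M - 1 < m]. *)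
have [r2|r2] := boolP (2 <= rank M); last first.
  by rewrite (trace0 P) // cP; lia.
have [rm|rm] := boolP (rank M <= m); last first.
  by rewrite (trace0 set0) ?sub0set ?muln0 // cards0; lia.
have [w rM] : exists w, rank M = w.+2 by exists (rank M - 2); lia.
have rP : rank M = #|P| + w by rewrite cP.
have r1 x : rank M = #|[set x]| + w.+1 by rewrite cards1.
have r0 : rank M = #|(set0 : {set T})| + w.+2 by rewrite cards0.
apply: (@shadow_inequality m w.+1 _ _ _ _
  #|nonbasis_link M P [set e]| #|nonbasis_link M P [set f]|).
- by lia.
- exact: bases_trace_le.
- by apply: bases_trace_le; rewrite ?sub0set.
- by apply: bases_trace_compl; rewrite // ?sub1set.
- by apply: bases_trace_compl; rewrite // ?sub1set.
- apply: upper_shadow_bound; first exact: separated_nonbasis_link.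
  by move=> A; apply: nonbasis_linkP.
- apply: lower_shadow_bound; first exact: separated_nonbasis_link.
  by move=> A; apply: nonbasis_linkP.
Qed.

(** * From counts of bases to probabilities *)

Import Order.TTheory GRing.Theory Num.Theory.

Lemma separated_negative_correlation M :
  separated (nonbases M) -> negative_correlation M.
Proof.
move=> sepM e f eM fM ef fNl.
pose n (a b : bool) := #|[set X in bases M | (e \in X) == a & (f \in X) == b]|.
have nE a b : n a b = #|bases_trace M [set e; f]
    ((if a then [set e] else set0) :|: (if b then [set f] else set0))|.
  apply: eq_card => X; rewrite !inE; congr (_ && _).
  apply/andP/eqP => [[/eqP <- /eqP <-]|/setP eqX].
    apply/setP => z; rewrite !inE; have [->|ze] := eqVneq z e.
      by case: (e \in X); case: (f \in X); rewrite !inE ?eqxx ?(negbTE ef).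
    have [->|zf] := eqVneq z f.
      by case: (e \in X); case: (f \in X);
         rewrite !inE ?eqxx // ?[f == e]eq_sym ?(negbTE ef).
    by rewrite andbF; case: (e \in X); case: (f \in X);
       rewrite !inE ?(negbTE ze) ?(negbTE zf).
  have := (eqX e, eqX f); rewrite !inE !eqxx orbT !andbT => -[-> ->].
  by case: a b {eqX} => [] []; rewrite !inE ?eqxx ?[f == e]eq_sym ?(negbTE ef).
have key : n true true * n false false <= n true false * n false true.
  by rewrite !nE set0U setU0 set0U; apply: bases_trace_inequality.
have nef : #|[set X in bases M | (e \in X) && (f \in X)]| = n true true.
  by apply: eq_card => X; rewrite !inE !eqb_id.
have ne : #|[set X in bases M | e \in X]| = n true true + n true false.
  rewrite -(cardsID [set X : {set T} | f \in X]).
  by congr (_ + _); apply: eq_card => X; rewrite !inE; do !case: (_ \in _).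
have nf : #|[set X in bases M | f \in X]| = n true true + n false true.
  rewrite -(cardsID [set X : {set T} | e \in X]).
  by congr (_ + _); apply: eq_card => X; rewrite !inE; do !case: (_ \in _).
have nb : #|bases M| =
    n true true + n true false + n false true + n false false.
  pose eX := [set X : {set T} | e \in X].
  pose fX := [set X : {set T} | f \in X].
  rewrite -(cardsID eX) -(cardsID fX (_ :&: _)) -(cardsID fX (_ :\: eX)) !addnA.
  by congr (_ + _ + _ + _); apply: eq_card => X; rewrite !inE;
     do !case: (_ \in _).
have nf_gt0 : 0 < #|[set X in bases M | f \in X]|.
  move: fNl; rewrite /loop fM => /forall_inPn[X bX /negPn fX].
  by apply/card_gt0P; exists X; rewrite inE bX.
have nb_gt0 : 0 < #|bases M| by rewrite card_gt0 bases_neq0.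
(* With [p], [q], [s], [t] the four counts, [p * (p + q + s + t) <= (p + q) * (p + s)] expands to
   [p * t <= q * s], which is [key]. *)
have main : n true true * #|bases M| <=
   #|[set X in bases M | e \in X]| * #|[set X in bases M | f \in X]|.
  by rewrite nb ne nf; nia.
rewrite /condPr /Pr /= nef.
have b0 : (0 < #|bases M|%:R :> rat)%R by rewrite ltr0n.
have f0 : (0 < #|[set X in bases M | f \in X]|%:R :> rat)%R by rewrite ltr0n.
(* The number of bases cancels in the conditional probability, leaving a ratio of two counts. *)
rewrite invf_div mulrA divfK ?gt_eqF //.
by rewrite ler_pdivrMr // mulrAC ler_pdivlMr // -!natrM ler_nat.
Qed.

End SparsePaving.

Theorem lemma2 (T : finType) (M : matroid T) (hM : sparse_paving M) :
  balanced M.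
Proof.
move=> N MN; apply: separated_negative_correlation.
exact: separated_minor (sparse_paving_separated hM) MN.
Qed.
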